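(* $\mathrm{ex}'(n,\{\text{nested},\text{swords}\})\in O(n)$.
   Context: Let $P$ be a set of $n$ points in convex position in the plane (the vertices of a convex $n$-gon); a triangle on $P$ is a 3-element subset of $P$. For two distinct triangles $t_1,t_2$ on $P$, label each point of $t_1\cup t_2$ by the triangle(s) containing it and read the points in their cyclic order around the polygon. The pair forms exactly one of eight configurations. (i) If $t_1,t_2$ share two vertices $u,v$: ''taco'' if their third vertices lie on the same side of the line $uv$, ''mariposa'' if on opposite sides. (ii) If they share exactly one vertex $v$: read the remaining four vertices in cyclic order starting just after $v$; ''bat'' if the pattern is $t_1t_1t_2t_2$ or $t_2t_2t_1t_1$, ''nested'' if it is $t_1t_2t_2t_1$ or $t_2t_1t_1t_2$, ''crossing'' if it is $t_1t_2t_1t_2$ or $t_2t_1t_2t_1$. (iii) If they share no vertex, the cyclic sequence of the six labels is, up to rotation, reflection and exchanging the roles of $t_1,t_2$, one of: ''ears'' $AAABBB$, ''swords'' $AABABB$, ''david'' $ABABAB$. Top/bottom variant: partition the vertices of the convex $n$-gon by a horizontal line into a top half of $\lceil n/2\rceil$ vertices and a bottom half of $\lfloor n/2\rfloor$ vertices (each half consisting of consecutive vertices along the polygon). For a set $X$ of configurations, $\mathrm{ex}'(n,X)$ is the maximum size of a family of triangles on $P$, each having exactly two vertices in the top half and one vertex in the bottom half, in which no two triangles form a configuration belonging to $X$. *)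

(* Defs.v *)
From HB Require Import structures.
From mathcomp Require Import all_boot.

Set Implicit Arguments.
Unset Strict Implicit.
Unset Printing Implicit Defensive.

Inductive configuration :=
  Taco | Mariposa | Bat | Nested | Crossing | Ears | Swords | David.

Definition configuration_to_ord (c : configuration) : 'I_8 :=
  match c with
  | Taco => inord 0 | Mariposa => inord 1 | Bat => inord 2 | Nested => inord 3
  | Crossing => inord 4 | Ears => inord 5 | Swords => inord 6 | David => inord 7
  end.

Definition configuration_of_ord (i : 'I_8) : configuration :=
  nth Taco [:: Taco; Mariposa; Bat; Nested; Crossing; Ears; Swords; David] i.

Lemma configuration_to_ordK :
  cancel configuration_to_ord configuration_of_ord.
Proof. by case; rewrite /configuration_of_ord /= inordK. Qed.

HB.instance Definition _ :=
  Countable.copy configuration (can_type configuration_to_ordK).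
HB.instance Definition _ : isFinite configuration :=
  CanIsFinite configuration_to_ordK.

(* The vertices of the convex n-gon are 'I_n, numbered in cyclic order along
   the polygon. *)
Section Configurations.
Variable n : nat.
Implicit Types (t : {set 'I_n}) (u v x y : 'I_n).

Definition is_triangle t : bool := #|t| == 3.

(* For distinct u and v, the vertices other than u and v on one side of the line
   uv are those numbered strictly between u and v; the remaining ones are on
   the other side. *)
Definition same_side u v x y : bool :=
  (minn u v < x < maxn u v) == (minn u v < y < maxn u v).

(* The words below have the letter true for a vertex of t1 and false for a
   vertex of t2. *)

Definition word_after v t1 t2 : seq bool :=
  [seq x \in t1 | x <- rot v.+1 (enum 'I_n) & x \in (t1 :|: t2) :\ v].

Definition cyclic_word t1 t2 : seq bool :=
  [seq x \in t1 | x <- enum 'I_n & x \in t1 :|: t2].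

(* Equality up to rotation, reflection and exchange of the two letters. *)
Definition dihedral_eq (w p : seq bool) : bool :=
  has (fun k => rot k w \in [:: p; rev p; map negb p; map negb (rev p)])
      (iota 0 (size w)).

Definition share_two (P : 'I_n -> 'I_n -> 'I_n -> 'I_n -> bool) t1 t2 : bool :=
  (#|t1 :&: t2| == 2) &&
  [forall u in t1 :&: t2, forall v in t1 :&: t2,
   forall x in t1 :\: t2, forall y in t2 :\: t1, (u != v) ==> P u v x y].

Definition share_one (patterns : seq (seq bool)) t1 t2 : bool :=
  [exists v, (t1 :&: t2 == [set v]) && (word_after v t1 t2 \in patterns)].

Definition share_none (p : seq bool) t1 t2 : bool :=
  (t1 :&: t2 == set0) && dihedral_eq (cyclic_word t1 t2) p.

(* Meaningful for distinct triangles t1 and t2. *)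
Definition forms (c : configuration) t1 t2 : bool :=
  let A := true in let B := false in
  match c with
  | Taco => share_two same_side t1 t2
  | Mariposa => share_two (fun u v x y => ~~ same_side u v x y) t1 t2
  | Bat => share_one [:: [:: A; A; B; B]; [:: B; B; A; A]] t1 t2
  | Nested => share_one [:: [:: A; B; B; A]; [:: B; A; A; B]] t1 t2
  | Crossing => share_one [:: [:: A; B; A; B]; [:: B; A; B; A]] t1 t2
  | Ears => share_none [:: A; A; A; B; B; B] t1 t2
  | Swords => share_none [:: A; A; B; A; B; B] t1 t2
  | David => share_none [:: A; B; A; B; A; B] t1 t2
  end.

(* The numbering starts at the first vertex of the top half;
   uphalf n is the ceiling of n/2. *)
Definition top_half : {set 'I_n} := [set i : 'I_n | i < uphalf n].
Definition bottom_half : {set 'I_n} := ~: top_half.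

Definition top_bottom_triangle t : bool :=
  [&& is_triangle t, #|t :&: top_half| == 2 & #|t :&: bottom_half| == 1].

Definition avoids (X : {set configuration}) (F : {set {set 'I_n}}) : bool :=
  [forall t1 in F, forall t2 in F, (t1 != t2) ==>
    [forall c in X, ~~ forms c t1 t2]].

End Configurations.

Definition ex' (n : nat) (X : {set configuration}) : nat :=
  \max_(F : {set {set 'I_n}} |
         [forall t in F, top_bottom_triangle t] && avoids X F) #|F|.

Definition is_bigO (f g : nat -> nat) : Prop :=
  exists C N : nat, forall n : nat, N <= n -> f n <= C * g n.

(* Main.v *)
Require Import Defs.
From mathcomp Require Import all_boot.
From mathcomp Require Import zify.

Set Implicit Arguments.
Unset Strict Implicit.
Unset Printing Implicit Defensive.

(** Write a triangle as [(a, b, c)] with [a < b] in the top half and [c] in the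
    bottom half. Avoiding nested and swords means, for two triangles [(a, b, c)]
    and [(a', b', c')]: neither of [[a, b]] and [[a', b']] contains the other in
    its interior; if [a <= a' < b <= b'] with [(a, b) <> (a', b')] then
    [c <= c']; if [b < a'] then [c' <= c].
    By the first condition [a + b] determines the top pair, so there are at most
    [2n] top pairs; discard the triangle with the least [c] above each of them.
    Let two of the other triangles share the bottom vertex [c]. Each of them has
    a companion with the same top pair and a smaller bottom vertex, and comparing
    one with the companion of the other excludes both [a' < b] and [b < a'], so
    [b = a']. This cannot hold pairwise for three triangles, so at most two of
    them are left at every [c]. *)

(** * Reading words off sorted vertex lists *)

Section Words.
Variable n : nat.
Implicit Types (v : 'I_n) (t : {set 'I_n}) (s : seq 'I_n) (P : pred 'I_n).

Lemma filter_enum_ord_sorted P s :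
  sorted ltn (map val s) -> s =i P -> [seq x <- enum 'I_n | P x] = s.
Proof.
move=> s_sorted sP; apply: (inj_map val_inj).
apply: (irr_sorted_eq ltn_trans ltnn) => //.
  apply: (subseq_sorted ltn_trans (map_subseq _ (filter_subseq _ _))).
  by rewrite val_enum_ord iota_ltn_sorted.
by apply: eq_mem_map => x; rewrite mem_filter mem_enum andbT sP.
Qed.

(** The rotation by [v.+1] starts just after [v], so [v] itself closes the second block. *)
Lemma filter_rot_enum_ord v P :
  [seq x <- rot v.+1 (enum 'I_n) | P x] =
  [seq x : 'I_n <- enum 'I_n | (v < x) && P x] ++
  [seq x : 'I_n <- enum 'I_n | (x <= v) && P x].
Proof.
have vn := ltn_ord v.
have all_take : all (fun x : 'I_n => x <= v) (take v.+1 (enum 'I_n)).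
  rewrite -(all_map val (fun i => i <= v)) map_take val_enum_ord take_iota.
  by apply/allP => i; rewrite mem_iota; lia.
have all_drop : all (fun x : 'I_n => v < x) (drop v.+1 (enum 'I_n)).
  rewrite -(all_map val (fun i => v < i)) map_drop val_enum_ord drop_iota.
  by apply/allP => i; rewrite mem_iota; lia.
rewrite /rot filter_cat -{3 4}(cat_take_drop v.+1 (enum 'I_n)) !filter_cat.
have drop0 Q s : all (fun x => ~~ Q x) s -> [seq x <- s | Q x && P x] = [::].
  move=> /allP sQ; apply/eqP; rewrite -[_ == _]negbK -has_filter.
  by apply/hasPn => x /sQ /negbTE ->.
have keep Q s : all Q s -> [seq x <- s | Q x && P x] = [seq x <- s | P x].
  by move=> /allP sQ; apply: eq_in_filter => x /sQ ->.
rewrite (keep _ _ all_take) (keep _ _ all_drop) drop0 ?cats0; last first.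
  by apply: sub_all all_take => x; lia.
rewrite drop0 ?cats0 //.
by apply: sub_all all_drop => x; lia.
Qed.

Lemma cyclic_word_sorted t1 t2 s :
  sorted ltn (map val s) -> s =i t1 :|: t2 ->
  cyclic_word t1 t2 = [seq x \in t1 | x <- s].
Proof. by move=> *; rewrite /cyclic_word (filter_enum_ord_sorted (s := s)). Qed.

Lemma word_after_sorted v t1 t2 s1 s2 :
  sorted ltn (map val s1) -> sorted ltn (map val s2) ->
  s1 =i [pred x : 'I_n | (v < x) && (x \in t1 :|: t2)] ->
  s2 =i [pred x : 'I_n | (x < v) && (x \in t1 :|: t2)] ->
  word_after v t1 t2 = [seq x \in t1 | x <- s1 ++ s2].
Proof.
move=> s1_sorted s2_sorted s1P s2P; rewrite /word_after filter_rot_enum_ord.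
(* The block [x <= v] becomes [x < v] because [word_after] removes [v]. *)
congr (map _ (_ ++ _)); apply: filter_enum_ord_sorted => // x;
  rewrite ?s1P ?s2P [RHS]unfold_in !inE -val_eqE /=; move: (_ || _) => b; lia.
Qed.

End Words.

(** * Constraints on two triangles of the family *)

Section Pairs.
Variables (n : nat) (F : {set {set 'I_n}}).
Implicit Types (t : {set 'I_n}) (s : seq 'I_n).
Hypothesis F_avoids : avoids [set Nested; Swords] F.

Lemma avoids_not_nested t1 t2 v s1 s2 :
  t1 \in F -> t2 \in F -> t1 :&: t2 = [set v] ->
  sorted ltn (map val s1) -> sorted ltn (map val s2) ->
  s1 =i [pred x : 'I_n | (v < x) && (x \in t1 :|: t2)] ->
  s2 =i [pred x : 'I_n | (x < v) && (x \in t1 :|: t2)] ->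
  [seq x \in t1 | x <- s1 ++ s2] \in
    [:: [:: true; false; false; true]; [:: false; true; true; false]] -> False.
Proof.
move=> t1F t2F t12 s1_sorted s2_sorted s1P s2P word_in.
have word := word_after_sorted s1_sorted s2_sorted s1P s2P.
have [t12E|t12D] := eqVneq t1 t2.
  (* If the triangles were equal, every listed vertex would lie in [t1], yet the word contains
     [false]. *)
  have: false \in [seq x \in t1 | x <- s1 ++ s2].
    by move: word_in; rewrite !inE => /orP[] /eqP ->.
  case/mapP=> x; rewrite mem_cat s1P s2P /= -t12E setUid => /orP[] /andP[_ ->] //.
move/forall_inP: F_avoids => /(_ _ t1F) /forall_inP /(_ _ t2F).
rewrite t12D => /forall_inP /(_ Nested); rewrite !inE eqxx => /(_ isT) /negP[].
by apply/existsP; exists v; rewrite t12 eqxx word.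
Qed.

Lemma avoids_not_swords t1 t2 s :
  t1 \in F -> t2 \in F -> t1 :&: t2 = set0 ->
  sorted ltn (map val s) -> s =i t1 :|: t2 ->
  dihedral_eq [seq x \in t1 | x <- s] [:: true; true; false; true; false; false] ->
  False.
Proof.
move=> t1F t2F t12 s_sorted sP sw.
have word := cyclic_word_sorted s_sorted sP.
have [t12E|t12D] := eqVneq t1 t2.
  (* Equal and disjoint sets are empty, and [dihedral_eq] has no rotation to try on an empty
     word. *)
  have t10 : t1 = set0 by rewrite -t12 -t12E setIid.
  have s0 : s = [::].
    by case: s sP {s_sorted sw word} => // x s /(_ x); rewrite -t12E t10 !inE eqxx.
  by move: sw; rewrite s0.
move/forall_inP: F_avoids => /(_ _ t1F) /forall_inP /(_ _ t2F).
rewrite t12D => /forall_inP /(_ Swords); rewrite !inE eqxx orbT => /(_ isT) /negP[].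
by rewrite /forms /share_none t12 eqxx word.
Qed.

Ltac solve_word w :=
  match goal with |- context [map ?f ?s] =>
    have -> : map f s = w
      by rewrite /= !inE -!val_eqE /=;
         congr [:: _; _; _; _; _; _] || congr [:: _; _; _; _]; lia
  end.

Ltac set_lia :=
  first [ by rewrite /=; lia
        | by apply/setP => x; rewrite !inE -!val_eqE /=; lia
        | by move=> x; rewrite ?in_nil !inE -!val_eqE /=; lia ].

Variable m : nat.
Variables a b c a' b' c' : 'I_n.
Hypotheses (abF : [set a; b; c] \in F) (abF' : [set a'; b'; c'] \in F).
Hypotheses (ab : a < b) (bm : b < m) (mc : m <= c).
Hypotheses (ab' : a' < b') (bm' : b' < m) (mc' : m <= c').

(** Below tops in the order [a], [a'], [b'], [b], distinct bottom vertices give swords in either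
    order, and a common one gives nested. *)
Lemma avoids_no_strict_nesting : ~~ ((a < a') && (b' < b)).
Proof.
apply/negP => /andP[aa' b'b].
have [cc'|c'c|/val_inj cc'] := ltngtP c c'.
- apply: (avoids_not_swords (s := [:: a; a'; b'; b; c; c']) abF abF'); try set_lia.
  by solve_word [:: true; false; false; true; true; false].
- apply: (avoids_not_swords (s := [:: a; a'; b'; b; c'; c]) abF abF'); try set_lia.
  by solve_word [:: true; false; false; true; false; true].
- subst c'.
  apply: (avoids_not_nested (v := c) (s1 := [::]) (s2 := [:: a; a'; b'; b])
    abF abF'); try set_lia.
  by solve_word [:: true; false; false; true].
Qed.

(** If [c' < c], top pairs sharing their left or their right vertex give nested, and disjoint ones
    give swords. *)
Lemma avoids_crossing_tops_le :
  a <= a' -> b <= b' -> (a < a') || (b < b') -> a' < b -> c <= c'.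
Proof.
move=> aa' bb' neq_ab a'b; rewrite leqNgt; apply/negP => c'c.
have [lt_aa'|gt_aa'|/val_inj eq_aa'] := ltngtP a a'; last 1 first.
- subst a'; rewrite ltnn /= in neq_ab.
  apply: (avoids_not_nested (v := a) (s1 := [:: b; b'; c'; c]) (s2 := [::])
    abF abF'); try set_lia.
  by solve_word [:: true; false; false; true].
- have [lt_bb'|gt_bb'|/val_inj eq_bb'] := ltngtP b b'; last 1 first.
  + subst b'.
    apply: (avoids_not_nested (v := b) (s1 := [:: c'; c]) (s2 := [:: a; a'])
      abF abF'); try set_lia.
    by solve_word [:: false; true; true; false].
  + apply: (avoids_not_swords (s := [:: a; a'; b; b'; c'; c]) abF abF'); try set_lia.
    by solve_word [:: true; false; true; false; false; true].
  + lia.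
- lia.
Qed.

(** If [c < c'], the cyclic word is AABBAB, a rotation of the reversed swords pattern. *)
Lemma avoids_separated_tops_ge : b < a' -> c' <= c.
Proof.
move=> ba'; rewrite leqNgt; apply/negP => cc'.
apply: (avoids_not_swords (s := [:: a; b; a'; b'; c; c']) abF abF'); try set_lia.
by solve_word [:: true; true; false; false; true; false].
Qed.

End Pairs.

(** * Counting triples *)

Section Counting.
Variables (n : nat) (T : {set 'I_n * 'I_n * 'I_n}).
Implicit Types p q r : 'I_n * 'I_n * 'I_n.

Hypothesis tops_lt : forall p, p \in T -> p.1.1 < p.1.2.
Hypothesis no_strict_nesting : forall p q, p \in T -> q \in T ->
  ~~ ((p.1.1 < q.1.1) && (q.1.2 < p.1.2)).
Hypothesis crossing_le : forall p q, p \in T -> q \in T ->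
  p.1.1 <= q.1.1 -> p.1.2 <= q.1.2 ->
  (p.1.1 < q.1.1) || (p.1.2 < q.1.2) -> q.1.1 < p.1.2 -> p.2 <= q.2.
Hypothesis separated_ge : forall p q, p \in T -> q \in T ->
  p.1.2 < q.1.1 -> q.2 <= p.2.

Definition lowest : {set 'I_n * 'I_n * 'I_n} :=
  [set p in T | [forall q in T, (q.1 == p.1) ==> (p.2 <= q.2)]].

Lemma card_lowest : #|lowest| <= n + n.
Proof.
have lt_sum p : p.1.1 + p.1.2 < n + n.
  by have := ltn_ord p.1.1; have := ltn_ord p.1.2; lia.
rewrite -[leqRHS]card_ord.
apply: (leq_card_in (fun p => Ordinal (lt_sum p))) => p q.
rewrite !inE => /andP[pT /forall_inP p_low] /andP[qT /forall_inP q_low].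
move=> /(congr1 val) /= eq_sum.
(* Different top pairs with the same sum would be strictly nested one way or the other. *)
have := no_strict_nesting pT qT; have := no_strict_nesting qT pT => nqp npq.
have eq1 : p.1.1 = q.1.1 by apply: val_inj => /=; lia.
have eq2 : p.1.2 = q.1.2 by apply: val_inj => /=; lia.
have eq_tops : p.1 = q.1.
  by rewrite [LHS]surjective_pairing [RHS]surjective_pairing eq1 eq2.
have := p_low q qT; have := q_low p pT; rewrite eq_tops eqxx /= => le1 le2.
have eq3 : p.2 = q.2 by apply: val_inj => /=; lia.
by rewrite [LHS]surjective_pairing [RHS]surjective_pairing eq_tops eq3.
Qed.

Lemma not_lowest_adjacent p q :
  p \in T :\: lowest -> q \in T :\: lowest -> p.2 = q.2 -> p != q ->
  (p.1.2 == q.1.1) || (q.1.2 == p.1.1).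
Proof.
have lower r : r \in T :\: lowest ->
    r \in T /\ exists r', [/\ r' \in T, r'.1 = r.1 & r'.2 < r.2].
  rewrite !inE => /andP[]; case rT: (r \in T) => //= /forall_inPn[r' r'T].
  by rewrite negb_imply -ltnNge => /andP[/eqP ? ?] _; split=> //; exists r'.
move=> /lower[pT [p' [p'T p'1 p'2]]] /lower[qT [q' [q'T q'1 q'2]]] eq2 neq.
have neq1 : (p.1.1 != q.1.1 :> nat) || (p.1.2 != q.1.2 :> nat).
  apply: contraNT neq; rewrite negb_or !negbK => /andP[/eqP e1 /eqP e2].
  apply/eqP; move: p q eq2 e1 e2 {pT qT p'1 p'2 q'1 q'2}.
  by move=> [[a b] c] [[a' b'] c'] /= -> /val_inj -> /val_inj ->.
have := tops_lt pT; have := tops_lt qT.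
have := no_strict_nesting pT qT; have := no_strict_nesting qT pT.
(* With [p] on the left, overlapping tops give [p.2 <= q'.2 < q.2], and separated tops give
   [q.2 <= p'.2 < p.2]; both contradict [p.2 = q.2]. The case with [q] on the left is symmetric. *)
have := crossing_le pT q'T; have := crossing_le qT p'T.
have := separated_ge pT qT; have := separated_ge p'T qT.
have := separated_ge qT pT; have := separated_ge q'T pT.
rewrite p'1 q'1 -!val_eqE /=; rewrite eq2 in p'2 *; lia.
Qed.

(** Split by [has_left]: whether some remaining triple over the same bottom vertex has its top pair
    end where that of [p] begins. On each of the two classes the bottom vertex is injective. *)
Lemma card_not_lowest : #|T :\: lowest| <= n + n.
Proof.
set U := T :\: lowest.
pose has_left p := [exists q in U, (q.2 == p.2) && (q.1.2 == p.1.1)].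
(* No chain of three: its ends [p] and [r] would have to touch as well, but the top pair of [q]
   separates theirs. *)
have sep p q r : p \in U -> q \in U -> r \in U -> p.2 = q.2 -> q.2 = r.2 ->
    p.1.2 = q.1.1 -> q.1.2 = r.1.1 -> False.
  move=> pU qU rU pq qr pq1 qr1.
  have UT s : s \in U -> s \in T by case/setDP.
  have := tops_lt (UT _ pU); have := tops_lt (UT _ qU); have := tops_lt (UT _ rU).
  move=> lt_r lt_q lt_p.
  have neq : p != r by apply/eqP => E; subst r; rewrite pq1 -qr1 in lt_p; lia.
  have := not_lowest_adjacent pU rU (etrans pq qr) neq.
  by rewrite -!val_eqE /= pq1 -qr1; rewrite pq1 in lt_p; rewrite -qr1 in lt_r; lia.
have half_inj (e : bool) : #|[set p in U | has_left p == e]| <= n.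
  rewrite -[leqRHS]card_ord.
  apply: (leq_card_in (fun p => p.2)).
  have wlog_adj p q : p \in U -> q \in U -> has_left p = has_left q ->
      p.2 = q.2 -> p.1.2 = q.1.1 -> False.
    move=> pU qU e_pq pq adj.
    (* Here [p] is a left neighbour of [q]; being in the same class, [p] has a left neighbour [r],
       and [r], [p], [q] form a chain. *)
    have: has_left q by apply/exists_inP; exists p; rewrite ?pq ?adj ?eqxx.
    rewrite -e_pq => /exists_inP[r rU /andP[/eqP rp /eqP r1]].
    exact: (sep r p q).
  move=> p q /setIdP[pU /eqP ep] /setIdP[qU /eqP eq] /= pq.
  apply/eqP; apply: contraT => neq.
  have /orP[/eqP adj|/eqP adj] := not_lowest_adjacent pU qU pq neq.
    by case: (wlog_adj p q) => //; rewrite ep eq.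
  by case: (wlog_adj q p) => //; rewrite ep eq.
have -> : U = [set p in U | has_left p == true] :|:
              [set p in U | has_left p == false].
  apply/setP => p; apply/idP/setUP => [pU|[] /setIdP[] //].
  by case E: (has_left p); [left|right]; apply/setIdP; rewrite E.
exact: leq_trans (leq_card_setU _ _) (leq_add (half_inj true) (half_inj false)).
Qed.

Lemma card_triples_le : #|T| <= 4 * n.
Proof.
rewrite -(cardsID lowest T).
have := subset_leq_card (subsetIr T lowest).
by have := card_lowest; have := card_not_lowest; lia.
Qed.

End Counting.

(** * From triangles to ordered triples *)

Lemma top_bottom_triangleP n (t : {set 'I_n}) : top_bottom_triangle t ->
  exists a b c : 'I_n,
    [/\ t = [set a; b; c], a < b, b < uphalf n & uphalf n <= c].
Proof.
case/and3P=> _ /cards2P[a [b [neq_ab tab]]] /cards1P[c tc].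
have inab x : (x \in t) && (x < uphalf n) = (x == a) || (x == b).
  by have /setP/(_ x) := tab; rewrite !inE.
have inc x : (x \in t) && ~~ (x < uphalf n) = (x == c).
  by have /setP/(_ x) := tc; rewrite !inE.
have /andP[_ am] : (a \in t) && (a < uphalf n) by rewrite inab eqxx.
have /andP[_ bm] : (b \in t) && (b < uphalf n) by rewrite inab eqxx orbT.
have /andP[_ cm] : (c \in t) && ~~ (c < uphalf n) by rewrite inc.
rewrite -leqNgt in cm.
have tE : t = [set a; b; c].
  apply/setP => x; rewrite !inE -inab -inc.
  by case: (x \in t); case: (_ < _).
have [lt_ab|lt_ba|/val_inj E] := ltngtP a b.
- by exists a, b, c.
- by exists b, a, c; rewrite tE (setUC [set b]).
- by rewrite E eqxx in neq_ab.
Qed.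

Lemma card_avoids_nested_swords n (F : {set {set 'I_n}}) :
  [forall t in F, top_bottom_triangle t] ->
  avoids [set Nested; Swords] F -> #|F| <= 4 * n.
Proof.
move=> /forall_inP F_tb F_av.
pose tri (p : 'I_n * 'I_n * 'I_n) := [set p.1.1; p.1.2; p.2].
pose T := [set p | [&& tri p \in F, p.1.1 < p.1.2, p.1.2 < uphalf n
                     & uphalf n <= p.2]].
(* Covering [F] by the image of [T] suffices, since an image has at most as many elements as [T]. *)
have F_sub : F \subset tri @: T.
  apply/subsetP => t tF.
  have [a [b [c [tE ab bm mc]]]] := top_bottom_triangleP (F_tb t tF).
  by apply/imsetP; exists (a, b, c); rewrite // inE /tri /= -tE tF ab bm mc.
apply: leq_trans (subset_leq_card F_sub) (leq_trans (leq_imset_card _ _) _).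
apply: card_triples_le => [p|p q|p q|p q].
- by rewrite inE => /and4P[].
- rewrite !inE => /and4P[pF p1 p2 p3] /and4P[qF q1 q2 q3].
  exact: (avoids_no_strict_nesting F_av pF qF p1 p2 p3 q1 q2 q3).
- rewrite !inE => /and4P[pF p1 p2 p3] /and4P[qF q1 q2 q3].
  exact: (avoids_crossing_tops_le F_av pF qF p1 p2 p3 q1 q2 q3).
- rewrite !inE => /and4P[pF p1 p2 p3] /and4P[qF q1 q2 q3].
  exact: (avoids_separated_tops_ge F_av pF qF p1 p2 p3 q1 q2 q3).
Qed.

Theorem theorem13 :
  is_bigO (fun n : nat => ex' n [set Nested; Swords]) (fun n : nat => n).
Proof.
(* The constant 4 adds [2n] for the lowest triples and [2n] for the others. *)
exists 4, 0 => n _; apply/bigmax_leqP => F /andP[F_tb F_av].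
exact: card_avoids_nested_swords.
Qed.
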